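(* Let $k\geq 2$ be an integer. For any real number $\delta>0$, there exists an $n_0$ such that for all $n\geq n_0$, $$t\bigl(n, GR_{k-1}(K_3)-1\bigr)\leq f_{k}(n, K_3)<t\bigl(n, GR_{k-1}(K_3)-1\bigr)+\delta n^2.$$
   Context: A $k$-edge-coloring of a graph is a map from its edge set to $[k]=\{1,\dots,k\}$ (not necessarily proper). A subgraph is rainbow if all its edges have distinct colors and monochromatic if all its edges have the same color. A Gallai-$k$-coloring is a $k$-edge-coloring of a complete graph containing no rainbow triangle. For a graph $H$ and positive integer $k$, the Gallai-Ramsey number $GR_k(H)$ is the minimum integer $N$ such that every Gallai-$k$-coloring of $K_N$ contains a monochromatic copy of $H$. For $k\geq 2$, $f_k(n,H)$ denotes the maximum, over all $k$-edge-colorings of $K_n$, of the number of edges that are contained in no rainbow triangle and in no monochromatic copy of $H$. $t(n,r)$ denotes the number of edges of the Turán graph $T_r(n)$, the complete $r$-partite graph on $n$ vertices with part sizes as equal as possible. *)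

(* Defs.v *)
From mathcomp Require Import all_boot all_order all_algebra.
From mathcomp Require Import boolp reals.

Set Implicit Arguments.
Unset Strict Implicit.
Unset Printing Implicit Defensive.

Record sgraph := SGraph {
  vertex :> finType;
  adj : rel vertex;
  adj_sym : symmetric adj;
  adj_irr : irreflexive adj }.

Definition edge_set (G : sgraph) : {set {set G}} :=
  [set [set p.1; p.2] | p : G * G & adj p.1 p.2].

Definition edge (G : sgraph) : finType := {e : {set G} | e \in edge_set G}.

Fact neq_sym (T : eqType) : symmetric (fun x y : T => x != y).
Proof. by move=> x y; rewrite eq_sym. Qed.

Fact neq_irr (T : eqType) : irreflexive (fun x y : T => x != y).
Proof. by move=> x; rewrite eqxx. Qed.

Definition complete_graph (n : nat) : sgraph :=
  SGraph (@neq_sym 'I_n) (@neq_irr 'I_n).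

Notation "''K_' n" := (complete_graph n) (at level 8, n at level 2).

(* For r > 0 the parts of the Turan graph are the residue classes modulo r in
   {0, ..., n-1}; each of them has size floor(n/r) or ceil(n/r). *)
Fact turan_sym (n r : nat) : symmetric (fun i j : 'I_n => i %% r != j %% r).
Proof. by move=> i j; rewrite eq_sym. Qed.

Fact turan_irr (n r : nat) : irreflexive (fun i j : 'I_n => i %% r != j %% r).
Proof. by move=> i; rewrite eqxx. Qed.

Definition turan_graph (n r : nat) : sgraph :=
  SGraph (@turan_sym n r) (@turan_irr n r).

Definition turan (n r : nat) : nat := #|edge_set (turan_graph n r)|.

(* F is the set of edges of a (not necessarily induced) copy of H in G. *)
Definition is_copy (H G : sgraph) (F : {set edge G}) : bool :=
  [exists f : {ffun H -> G},
    [&& injectiveb f,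
        [forall x, forall y, adj x y ==> adj (f x) (f y)]
      & F == [set e : edge G | val e \in [set f @: h | h : {set H} in edge_set H]]]].

Definition coloring (k : nat) (G : sgraph) : finType := {ffun edge G -> 'I_k}.

Section Colorings.
Variables (k : nat) (G : sgraph) (c : coloring k G).

Definition rainbow (F : {set edge G}) : bool :=
  [forall e in F, forall e' in F, (c e == c e') ==> (e == e')].

Definition monochromatic (F : {set edge G}) : bool :=
  [forall e in F, forall e' in F, c e == c e'].

Definition has_rainbow_triangle : bool :=
  [exists F : {set edge G}, is_copy 'K_3 F && rainbow F].

Definition has_monochromatic_copy (H : sgraph) : bool :=
  [exists F : {set edge G}, is_copy H F && monochromatic F].

Definition in_rainbow_triangle (e : edge G) : bool :=
  [exists F : {set edge G}, [&& is_copy 'K_3 F, rainbow F & e \in F]].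

Definition in_monochromatic_copy (H : sgraph) (e : edge G) : bool :=
  [exists F : {set edge G}, [&& is_copy H F, monochromatic F & e \in F]].

End Colorings.

Definition gallai (k n : nat) (c : coloring k 'K_n) : bool :=
  ~~ has_rainbow_triangle c.

Definition gallai_ramsey_property (k : nat) (H : sgraph) (N : nat) : bool :=
  [forall c : coloring k 'K_N, gallai c ==> has_monochromatic_copy c H].

(* Some N has the property by Ramsey's theorem, so the value 0 in the second
   branch is never taken. *)
Definition GR (k : nat) (H : sgraph) : nat :=
  if pselect (exists N, gallai_ramsey_property k H N) is left exN
  then ex_minn exN else 0.

Definition fNIM (k n : nat) (H : sgraph) : nat :=
  \max_(c : coloring k 'K_n)
    #|[set e : edge 'K_n |
        ~~ in_rainbow_triangle c e && ~~ in_monochromatic_copy c H e]|.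

(* Main.v *)
Require Import Defs.
From mathcomp Require Import all_boot all_order all_algebra.
From mathcomp Require Import boolp reals.
From mathcomp Require Import ring lra zify.
Import Order.TTheory GRing.Theory Num.Theory.

Set Implicit Arguments.
Unset Strict Implicit.
Unset Printing Implicit Defensive.

(** Put w(s) = 1 / g(s), where g(2m) = 5^m and g(2m + 1) = 2 * 5^m. In a Gallai
    coloring without monochromatic triangles, the sum of w(s(v)) over the
    vertices v is at most 1, where s(v) is the number of colors seen by v: a
    nontrivial homogeneous set can be contracted, and without such sets at most
    two colors occur, hence at most R(3,3) - 1 = 5 vertices. This gives
    GR_k(K_3) = g(k) + 1, and it shows that a coloring with k colors in which
    every vertex misses a color has at most g(k - 1) vertices.

    Blowing up an extremal (k - 1)-coloring, with the last color inside the
    parts, gives the lower bound. For the upper bound, if r = g(k - 1) and there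
    are t(n, r) + delta n^2 edges in no rainbow or monochromatic triangle, these
    edges form a positive proportion of the possible (r + 1)-cliques, so one
    finds pairs x_i <> y_i for i <= r such that all edges between the i-th and
    j-th pairs are such edges of one color d(i, j). Then d is a Gallai
    coloring of K_{r+1} without monochromatic triangles, and the color of
    x_i y_i is not seen at i, which is a contradiction. *)

(** * The extremal sizes and their growth *)

Definition gallai_size (k : nat) : nat := 5 ^ k./2 * 2 ^ odd k.

Lemma gallai_sizeSS k : gallai_size k.+2 = 5 * gallai_size k.
Proof. by rewrite /gallai_size /= negbK expnS mulnA. Qed.

Lemma gallai_size_gt0 k : 0 < gallai_size k.
Proof. by rewrite muln_gt0 !expn_gt0. Qed.

(** The two sides differ only if [a] and [b] are both odd, where 2 * 2 becomes 5. *)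
Lemma gallai_sizeM a b : gallai_size a * gallai_size b <= gallai_size (a + b).
Proof.
rewrite /gallai_size halfD oddD mulnACA -expnD.
case: (odd a) (odd b) => -[] /=; rewrite ?addn0 ?add0n ?muln1 ?mul1n //.
by rewrite add1n (expnS 5) mulnC leq_mul2r orbT.
Qed.

Lemma gallai_size_homo : {homo gallai_size : a b / a <= b}.
Proof.
move=> a b /subnKC <-; apply: leq_trans (gallai_sizeM _ _).
by rewrite leq_pmulr // gallai_size_gt0.
Qed.

Definition gallai_on (V K : eqType) (c : V -> V -> K) (P : pred V) :=
  forall x y z, P x -> P y -> P z -> x != y -> y != z -> x != z ->
  [|| c x y == c y z, c x y == c x z | c y z == c x z].

Definition trifree_on (V K : eqType) (c : V -> V -> K) (P : pred V) :=
  forall x y z, P x -> P y -> P z -> x != y -> y != z -> x != z ->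
  ~~ ((c x y == c y z) && (c x y == c x z)).

(** * Components of one color and homogeneous sets *)

Section ColorComponents.
Variables (V : finType) (K : eqType) (c : V -> V -> K).
Hypothesis c_sym : forall x y, c x y = c y x.
Implicit Types (A B D M : {set V}) (x y z u v : V) (i j : K).

(** Unions of components of color [i] in [A]: connectedness is expressed by cuts and not by
    paths. *)
Definition color_closed A i B :=
  (B \subset A) && [forall x in B, forall y in A :\: B, c x y != i].

Definition color_connected A i :=
  [forall B, [&& color_closed A i B & B != set0] ==> (B == A)].

Definition homogeneous A M :=
  [forall z in A :\: M, forall x in M, forall y in M, c z x == c z y].

Lemma color_closedP A i B : reflect
  (B \subset A /\ forall x y, x \in B -> y \in A -> y \notin B -> c x y != i)
  (color_closed A i B).
Proof.
apply: (iffP andP) => -[sBA H]; split=> //.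
  move=> x y xB yA yNB; move/forall_inP: H => /(_ x xB) /forall_inP; apply.
  by rewrite inE yNB.
apply/forall_inP => x xB; apply/forall_inP => y; rewrite inE => /andP[yNB yA].
exact: H.
Qed.

Lemma homogeneousP A M : reflect
  (forall z x y, z \in A -> z \notin M -> x \in M -> y \in M -> c z x = c z y)
  (homogeneous A M).
Proof.
apply: (iffP forall_inP) => H.
  move=> z x y zA zM xM yM.
  have /H/forall_inP/(_ x xM)/forall_inP/(_ y yM)/eqP // : z \in A :\: M.
  by rewrite inE zM.
move=> z; rewrite inE => /andP[zM zA].
by apply/forall_inP => x xM; apply/forall_inP => y yM; apply/eqP/H.
Qed.

Lemma color_closedC A i B : color_closed A i B -> color_closed A i (A :\: B).
Proof.
move=> /color_closedP[_ H]; apply/color_closedP; rewrite subsetDl; split=> //.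
move=> x y; rewrite !inE => /andP[xB xA] yA; rewrite yA andbT negbK => yB.
by rewrite c_sym; exact: H.
Qed.

(* A minimal i-closed set, i.e. a connected component of color i, is
   homogeneous: a vertex outside seeing two colors on it would split it into
   two i-closed pieces. *)
Lemma component_exists A i D u : gallai_on c (mem A) ->
  color_closed A i D -> u \in D ->
  exists B, [/\ color_closed A i B, u \in B, B \subset D & homogeneous A B].
Proof.
move=> gA clD uD.
have := @minset_exists _ (fun B => color_closed A i B && (u \in B)) D.
rewrite clD uD => /(_ isT) [B /minsetP[/andP[clB uB] minB] sBD].
exists B; split=> //.
have [sBA nB] := color_closedP _ _ _ clB.
have inA x : x \in B -> x \in A by move/(subsetP sBA).
apply/homogeneousP => z x y zA zB xB yB.
suff {x y xB yB} H x : x \in B -> c z x = c z u by rewrite !H.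
move=> xB; apply/eqP.
pose B1 := [set x in B | c z x == c z u].
have sB1 : B1 \subset B by apply/subsetP => w; rewrite inE => /andP[].
suff /minB/(_ sB1) e : color_closed A i B1 && (u \in B1).
  by move: xB; rewrite -e inE => /andP[].
rewrite inE uB eqxx /= andbT; apply/color_closedP.
split=> [|a b]; first exact: subset_trans sB1 sBA.
rewrite inE => /andP[aB /eqP ca] bA; rewrite inE negb_and => bB1.
case: (boolP (b \in B)) bB1 => [bB /= cb|bB _]; last exact: nB.
have neq w : w \in B -> z != w by apply: contraTneq => <-.
have ab : a != b by apply: contraNneq cb => <-; rewrite ca.
(* The color of [a b] is that of [z a] or of [z b], and neither is [i] because [B] is closed. *)
have := gA z a b zA (inA _ aB) bA (neq _ aB) ab (neq _ bB).
rewrite ca [c z u == c z b]eq_sym (negPf cb) -ca /= => /orP[] /eqP e.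
  by rewrite -e c_sym nB.
by rewrite e c_sym nB.
Qed.

(* Deleting a vertex v keeps the three colors connected. Otherwise color i
   falls apart in A - v, and v is joined in color i to each of its components.
   Only one color occurs between two components, so an edge of color j <> i
   from v to a component forces color j between that component and the others;
   the colors j and l would both be forced between two components. *)
Lemma three_connected_colors A i j l : gallai_on c (mem A) ->
  uniq [:: i; j; l] -> color_connected A i -> color_connected A j ->
  color_connected A l -> #|A| <= 1.
Proof.
have [n] := ubnP #|A|; elim: n => // n IHn in A i j l *; rewrite ltnS => leAn.
move=> gA uq ci cj cl; case: leqP => // A_gt1.
have [v vA] : exists v, v \in A by apply/card_gt0P/ltnW.
have cA' : #|A :\ v|.+1 = #|A| by rewrite [RHS](cardsD1 v) vA.
have seen i' : color_connected A i' -> exists2 u, u \in A :\ v & c v u = i'.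
  move=> /forallP/(_ [set v]) /implyP H; apply/'exists_in_eqP;
    apply: contraT => /exists_inPn N.
  suff /H/eqP e : color_closed A i' [set v] && ([set v] != set0).
    by rewrite -e cards1 in A_gt1.
  rewrite -card_gt0 cards1 andbT; apply/color_closedP.
  split=> [|x y /set1P -> yA yv]; first by rewrite sub1set.
  by apply: N; rewrite in_setD yv.
have gA' : gallai_on c (mem (A :\ v)).
  by move=> x y z /setD1P[_ xA] /setD1P[_ yA] /setD1P[_ zA]; exact: gA.
suff H i' j' l' : uniq [:: i'; j'; l'] -> color_connected A i' ->
    color_connected A j' -> color_connected A l' -> color_connected (A :\ v) i'.
  have le1 : #|A :\ v| <= 1.
    apply: (IHn _ i j l) => //; first by rewrite -ltnS cA';
      exact: leq_trans leAn _.
    - exact: (H i j l).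
    - apply: (H j i l) => //; move: uq; rewrite /= !inE !negb_or !andbT.
      by rewrite [j == i]eq_sym; case: (i == j) (i == l) (j == l) => [] [] [].
    - apply: (H l i j) => //; move: uq; rewrite /= !inE !negb_or !andbT.
      rewrite [l == i]eq_sym [l == j]eq_sym.
      by case: (i == j) (i == l) (j == l) => [] [] [].
  have [u uA' vu] := seen i ci; have [w wA' vw] := seen j cj.
  have e : u = w by apply: (card_le1_eqP le1).
  by move: uq; rewrite /= -vu -vw e !inE eqxx.
move=> {i j l uq ci cj cl IHn}; move: i' j' l' => i j l uq ci cj cl.
have [nij nil njl] : [/\ i != j, i != l & j != l].
  by move: uq; rewrite /= !inE negb_or !andbT => /andP[/andP[-> ->] ->].
have [nji nli] : j != i /\ l != i by rewrite ![_ == i]eq_sym.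
apply/forallP => D0; apply/implyP => /andP[clD0 D0n]; apply: contraT => D0A.
have joined D : color_closed (A :\ v) i D -> D != set0 ->
    exists2 y, y \in D & c v y = i.
  move=> /color_closedP[sD nD] Dn.
  apply/'exists_in_eqP; apply: contraT => /exists_inPn N.
  have vD : v \notin D by apply/negP => /(subsetP sD); rewrite !inE eqxx.
  suff cl' : color_closed A i D && (D != set0).
    move/forallP: ci => /(_ D); rewrite cl' /= => /eqP e.
    by rewrite e vA in vD.
  rewrite Dn andbT; apply/color_closedP.
  split=> [|x y xD yA yD]; first by apply: subset_trans sD (subsetDl _ _).
  have [->|yv] := eqVneq y v; first by rewrite c_sym; move: (N _ xD).
  by apply: nD => //; rewrite !inE yv.
have [u uA' vu] := seen j cj; have [w wA' vw] := seen l cl.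
have comp t : t \in A :\ v -> exists B, [/\ color_closed (A :\ v) i B,
    t \in B, B != A :\ v & homogeneous (A :\ v) B].
  move=> tA'; have [tD|tD] := boolP (t \in D0).
    have [B [clB tB sB hB]] := component_exists gA' clD0 tD.
    exists B; split=> //; apply: contraNneq D0A => e; rewrite eqEsubset.
    by rewrite -{2}e sB andbT; case/color_closedP: clD0.
  have tD' : t \in (A :\ v) :\: D0 by rewrite inE tD.
  have [B [clB tB sB hB]] := component_exists gA' (color_closedC clD0) tD'.
  exists B; split=> //; apply: contraNneq D0n => e; rewrite -subset0.
  apply/subsetP => x xD; case/color_closedP: clD0 => /subsetP /(_ x xD) xA _.
  by move: xA; rewrite -e => /(subsetP sB); rewrite inE xD.
have neqv t : t \in A :\ v -> v != t by case/setD1P; rewrite eq_sym.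
have inA t : t \in A :\ v -> t \in A by case/setD1P.
have force B a t y : color_closed (A :\ v) i B -> t \in B -> y \in A :\ v ->
    y \notin B -> c v t = a -> a != i -> c v y = i -> c t y = a.
  move=> /color_closedP[/subsetP sB nB] tB yA yB vt ai vy.
  have tA := sB _ tB.
  have ty : t != y by apply: contraNneq yB => <-.
  have := gA v t y vA (inA _ tA) (inA _ yA) (neqv _ tA) ty (neqv _ yA).
  rewrite vt vy (negPf ai) /= (negPf (nB _ _ tB yA yB)) orbF.
  by move/eqP.
have [B [clB uB BA /homogeneousP hB]] := comp u uA'.
(* If [u] and [w] share a component, a vertex outside sees it in both colors [j] and [l]. Otherwise
   the edge [u w] gets both colors. *)
have [wB|wB] := boolP (w \in B).
  have [|y yB vy] := joined _ (color_closedC clB).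
    rewrite -subset0; apply: contraNN BA => H; rewrite eqEsubset.
    case/color_closedP: (clB) => -> _ /=.
    by move: H; rewrite subset0 setD_eq0.
  case/setDP: yB => yA' yB.
  have e1 := force _ _ _ _ clB uB yA' yB vu nji vy.
  have e2 := force _ _ _ _ clB wB yA' yB vw nli vy.
  move: njl; rewrite -e1 -e2 -!(c_sym y) (hB y u w) ?eqxx //.
have wC : w \in (A :\ v) :\: B by rewrite inE wB.
have [C [clC wC' sC /homogeneousP hC]] :=
  component_exists gA' (color_closedC clB) wC.
have [|y yC vy] := joined _ clC; first by apply/set0Pn; exists w.
have [|x xB vx] := joined _ clB; first by apply/set0Pn; exists u.
have /setDP[yA' yB] := subsetP sC _ yC.
have xC : x \notin C by apply: contraL xB => /(subsetP sC) /setDP[].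
have uC : u \notin C by apply: contraL uB => /(subsetP sC) /setDP[].
have xA' : x \in A :\ v by case/color_closedP: clB => /subsetP -> .
have e1 := force _ _ _ _ clB uB yA' yB vu nji vy.
have e2 := force _ _ _ _ clC wC' xA' xC vw nli vx.
move: njl; rewrite -e1 -e2 (hC u y w) // c_sym (hB w u x) ?eqxx //.
Qed.
End ColorComponents.

(** * Colors seen by a vertex and the weight inequality *)

Section ColorDegree.
Variables (V K : finType) (c : V -> V -> K).
Hypothesis c_sym : forall x y, c x y = c y x.
Implicit Types (A B D M : {set V}) (x y z u v : V) (i j : K).

Definition seen A v : {set K} := [set c v u | u in A :\ v].

Lemma mem_seen A v u : u \in A -> u != v -> c v u \in seen A v.
Proof. by move=> uA uv; apply: imset_f; rewrite !inE uv. Qed.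

(** The color of an edge [x y] is connected, since a smaller component containing [x] and [y] would
    be a nontrivial homogeneous set. Three connected colors are impossible. *)
Lemma two_color_prime A : 2 < #|A| -> gallai_on c (mem A) ->
  (forall M, M \subset A -> 1 < #|M| < #|A| -> ~~ homogeneous c A M) ->
  exists a b, forall x y, x \in A -> y \in A -> x != y ->
    (c x y == a) || (c x y == b).
Proof.
move=> A_gt2 gA prim.
have conn x y : x \in A -> y \in A -> x != y -> color_connected c A (c x y).
  move=> xA yA xy; apply/forallP => D; apply/implyP => /andP[clD Dn].
  apply: contraT => DA.
  have [D' [xD' D'A clD']] : exists D', [/\ x \in D', D' != A &
      color_closed c A (c x y) D'].
    have [xD|xD] := boolP (x \in D); first by exists D.
    exists (A :\: D); split; first by rewrite inE xD.
      apply: contraNneq Dn => e; rewrite -subset0; apply/subsetP => z zD.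
      case/color_closedP: clD => /subsetP/(_ z zD).
      by rewrite -e inE zD.
    exact: color_closedC.
  have [B [clB xB sB hB]] := component_exists c_sym gA clD' xD'.
  have [sBA nB] := color_closedP _ _ _ _ clB.
  have yB : y \in B.
    by apply: contraT => yB; have := nB x y xB yA yB; rewrite eqxx.
  have /prim/negP[] // : 1 < #|B| < #|A|.
  apply/andP; split; first by apply/card_gt1P; exists x, y.
  apply: proper_card; rewrite properEneq sBA andbT.
  apply: contraNneq D'A => e; rewrite eqEsubset -{2}e sB andbT.
  by case/color_closedP: clD'.
have no3 x y z t u w : x \in A -> y \in A -> x != y -> z \in A -> t \in A ->
    z != t -> u \in A -> w \in A -> u != w ->
    ~~ uniq [:: c x y; c z t; c u w].
  move=> xA yA xy zA tA zt uA wA uw; apply/negP => uq.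
  have := three_connected_colors c_sym gA uq (conn _ _ xA yA xy)
    (conn _ _ zA tA zt) (conn _ _ uA wA uw).
  by rewrite leqNgt (ltnW A_gt2).
have /card_gt1P[x [y [xA yA xy]]] : 1 < #|A| by exact: ltnW.
have [/existsP[z /existsP[t /and4P[zA tA zt cn]]]|N] :=
  boolP [exists z, exists t, [&& z \in A, t \in A, z != t & c z t != c x y]].
  exists (c x y), (c z t) => u w uA wA uw.
  have := no3 _ _ _ _ _ _ xA yA xy zA tA zt uA wA uw.
  rewrite /= !inE andbT negb_and !negbK [c x y == c z t]eq_sym (negPf cn) /=.
  by rewrite ![_ == c u w]eq_sym.
exists (c x y), (c x y) => u w uA wA uw; rewrite orbb.
apply: contraNT N => cn; apply/existsP; exists u; apply/existsP; exists w.
by rewrite uA wA uw.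
Qed.

(** Three neighbors of [v] in one color would span a triangle of the other color, so [v] has at most
    two neighbors in each color. *)
Lemma ramsey33 A a b : trifree_on c (mem A) ->
  (forall x y, x \in A -> y \in A -> x != y -> (c x y == a) || (c x y == b)) ->
  #|A| <= 5.
Proof.
move=> tA two; have [//|A_gt5] := leqP.
have /card_gt0P[v vA] : 0 < #|A| by apply: leq_trans A_gt5.
have small i j : (forall x y, x \in A -> y \in A -> x != y ->
    (c x y == i) || (c x y == j)) -> #|[set u in A :\ v | c v u == i]| <= 2.
  move=> twoij; case: leqP => //; set N := [set _ in _ | _].
  move=> /card_gt2P[x [y [z [[xN yN zN] [xy yz zx]]]]].
  have inA t : t \in N -> [/\ t \in A, v != t & c v t == i].
    by rewrite !inE [v == t]eq_sym => /andP[/andP[-> ->] ->].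
  have all_j s t : s \in N -> t \in N -> s != t -> c s t = j.
    move=> /inA[sA vs /eqP cs] /inA[tA' vt /eqP ct] st.
    have := tA v s t vA sA tA' vs st vt.
    rewrite cs ct eqxx andbT eq_sym => /negPf ci.
    by have := twoij s t sA tA' st; rewrite ci => /eqP.
  have [/inA[xA _ _] /inA[yA _ _] /inA[zA _ _]] := And3 xN yN zN.
  have xz : x != z by rewrite eq_sym.
  by have := tA x y z xA yA zA xy yz xz; rewrite !all_j // eqxx.
have sub : A :\ v \subset
    [set u in A :\ v | c v u == a] :|: [set u in A :\ v | c v u == b].
  apply/subsetP => u uA'; case/setD1P: uA' => uv uA.
  by rewrite !inE uv uA; apply: two => //; rewrite eq_sym.
have le4 := leq_trans (subset_leq_card sub) (leq_card_setU _ _).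
have le2b : #|[set u in A :\ v | c v u == b]| <= 2.
  by apply: (small b a) => x y xA yA xy; rewrite orbC; exact: two.
have := leq_trans le4 (leq_add (small a b two) le2b).
by move: A_gt5; rewrite (cardsD1 v) vA; lia.
Qed.

Local Open Scope ring_scope.

(* For a homogeneous M, the bound for A follows from the bound for M and the
   bound for A with M contracted to a point: no color leaving M is used
   inside M, and gallai_size is supermultiplicative. *)
Lemma gallai_weight A : gallai_on c (mem A) -> trifree_on c (mem A) ->
  \sum_(v in A) ((gallai_size #|seen A v|)%:R^-1 : rat) <= 1.
Proof.
have [n] := ubnP #|A|; elim: n => // n IHn in A *; rewrite ltnS => leAn gA tA.
pose w s : rat := (gallai_size s)%:R^-1.
have w0 s : 0 <= w s by rewrite invr_ge0.
have wle a b : (a <= b)%N -> w b <= w a.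
  move=> ab; rewrite lef_pV2 ?posrE ?ltr0n ?gallai_size_gt0 //.
  by rewrite ler_nat gallai_size_homo.
have wM a b : w (a + b)%N <= w a * w b.
  have gM : (0 < gallai_size a * gallai_size b)%N by rewrite muln_gt0
    !gallai_size_gt0.
  rewrite /w -invfM -natrM lef_pV2 ?posrE ?ltr0n ?gM ?gallai_size_gt0 //.
  by rewrite ler_nat gallai_sizeM.
have subH (B : {set V}) : B \subset A ->
    gallai_on c (mem B) /\ trifree_on c (mem B).
  by move=> /subsetP s; split=> x y z /s xB /s yB /s zB; [apply: gA|apply: tA].
(* One vertex contributes [w 0] = 1, and two contribute at most 2 * [w 1] = 1. *)
have [A_gt2|A_le2] := ltnP 2 #|A|; last first.
  have wA v : v \in A -> w #|seen A v| <= w #|A|.-1.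
    move=> vA; apply: wle; have [A1|A1] := leqP #|A| 1.
      by apply: leq_trans (leq0n _); move: A1; case: #|A| => [|[]].
    apply: (@leq_trans 1); first by move: A_le2; lia.
    rewrite card_gt0; have : (0 < #|A :\ v|)%N by move: A1;
      rewrite (cardsD1 v) vA.
    by move=> /card_gt0P[u /setD1P[uv uA]]; apply/set0Pn; exists (c v u);
      apply: mem_seen.
  apply: (@le_trans _ _ (\sum_(v in A) w #|A|.-1)); first exact: ler_sum.
  rewrite sumr_const; move: A_le2; case: #|A| => [|[|[|]]] // _;
    rewrite ?mulr0n //.
case: (pickP (fun M : {set V} => [&& M \subset A, (1 < #|M| < #|A|)%N &
    homogeneous c A M])) => [M /and3P[sMA /andP[M1 MA] /homogeneousP hM]|prim].
  have /card_gt0P[m mM] : (0 < #|M|)%N by exact: ltnW.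
  have inA x : x \in M -> x \in A by move/(subsetP sMA).
  pose A' := m |: (A :\: M).
  have sA' : A' \subset A by rewrite subUset sub1set inA // subsetDl.
  have mA' : m \in A' by rewrite setU11.
  have cA' : (#|A'| < #|A|)%N.
    rewrite cardsU1 in_setD mM /= -(cardsID M A); rewrite (setIidPr sMA).
    by rewrite ltn_add2r.
  have [gM tM] := subH _ sMA; have [gA' tA'] := subH _ sA'.
  have IHM := IHn M (leq_trans MA leAn) gM tM.
  have IHA' := IHn A' (leq_trans cA' leAn) gA' tA'.
  apply: le_trans IHA'.
  rewrite (big_setID M) (setIidPr sMA) /= big_setU1 ?inE ?mM //=.
  apply: lerD; last first.
    apply: ler_sum => v /setDP[vA vM]; apply: wle; apply: subset_leq_card.
    apply/subsetP => _ /imsetP[u /setD1P[uv uA'] ->].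
    by apply: mem_seen => //; apply: (subsetP sA').
  apply: (@le_trans _ _ (\sum_(v in M) w #|seen M v| * w #|seen A' m|)).
    apply: ler_sum => v vM; apply: le_trans (wM _ _); apply: wle.
    have seenM t : t \in seen A' m ->
      exists2 z, z \in A :\: M & forall u, u \in M -> c u z = t.
      move=> /imsetP[z /setD1P[zm /setU1P[e|zA]] ->];
        first by rewrite e eqxx in zm.
      exists z => // u uM; rewrite c_sym [RHS]c_sym.
      by case/setDP: zA => zA zM; apply: hM.
    (* A common color would give a monochromatic triangle with two vertices in [M] and one
       outside. *)
    have dis : [disjoint seen M v & seen A' m].
      apply/pred0P => t /=; apply/negP =>
        /andP[/imsetP[u /setD1P[uv uM] tu] /seenM].
      move=> [z /setDP[zA zM] cz].
      have uz : u != z by apply: contraNneq zM => <-.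
      have vz : v != z by apply: contraNneq zM => <-.
      have vu : v != u by rewrite eq_sym.
      have := tA v u z (inA _ vM) (inA _ uM) zA vu uz vz.
      by rewrite -tu !cz // eqxx.
    rewrite -(leq_card_setU _ _).2 in dis *; move/eqP: dis => <-.
    apply: subset_leq_card; rewrite subUset; apply/andP; split.
      by apply/subsetP => _ /imsetP[u /setD1P[uv uM] ->];
        apply: mem_seen => //; exact: inA.
    apply/subsetP => t /seenM[z /setDP[zA zM] cz]; rewrite -(cz v vM).
    by apply: mem_seen => //; apply: contraNneq zM => ->.
  by rewrite -mulr_suml -[leRHS]mul1r ler_wpM2r.
have prim' M : M \subset A -> (1 < #|M| < #|A|)%N -> ~~ homogeneous c A M.
  by move=> sM cM; have := prim M; rewrite sM cM /= => ->.
have [a [b two]] := two_color_prime A_gt2 gA prim'.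
have A_le5 := ramsey33 tA two.
(* A vertex [v] seeing at most one color would make [A :\ v] homogeneous, so every weight is at most
   [w 2] = 1/5. *)
apply: (@le_trans _ _ (\sum_(v in A) w 2)).
  apply: ler_sum => v vA; apply: wle; rewrite ltnNge; apply/negP => le1.
  have cAv : (1 < #|A :\ v| < #|A|)%N.
    by move: A_gt2; rewrite [#|A|](cardsD1 v) vA; lia.
  have /negP[] := prim' _ (subsetDl A [set v]) cAv.
  apply/homogeneousP => z x y zA; rewrite !inE zA andbT negbK => /eqP ->.
  move=> /andP[xv xA] /andP[yv yA].
  by apply: (card_le1_eqP le1); apply: mem_seen.
have -> : w 2 = 5%:R^-1 by [].
by rewrite sumr_const -[_ *+ #|A|]mulr_natl ler_pdivrMr // mul1r ler_nat.
Qed.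

(** The weights sum to at most 1 and each is at least [1 / gallai_size s]. Taking for [s] the number
    of colors gives the Ramsey number; one less serves when each vertex misses a color. *)
Lemma gallai_card_le A s : gallai_on c (mem A) -> trifree_on c (mem A) ->
  (forall v, v \in A -> #|seen A v| <= s)%N -> (#|A| <= gallai_size s)%N.
Proof.
move=> gA tA le_s; have := gallai_weight gA tA.
have : \sum_(v in A) ((gallai_size s)%:R^-1 : rat) <=
       \sum_(v in A) (gallai_size #|seen A v|)%:R^-1.
  apply: ler_sum => v vA.
  by rewrite lef_pV2 ?posrE ?ltr0n ?gallai_size_gt0 // ler_nat
    gallai_size_homo ?le_s.
move=> /le_trans H /H; rewrite sumr_const -[_ *+ #|A|]mulr_natl.
by rewrite ler_pdivrMr ?ltr0n ?gallai_size_gt0 // mul1r ler_nat.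
Qed.
End ColorDegree.

(** * Gallai-Ramsey numbers of the triangle *)

Definition pentagon (a b : nat) : bool :=
  ((a + 1) %% 5 == b) || ((b + 1) %% 5 == a).

Lemma pentagonC a b : pentagon a b = pentagon b a.
Proof. exact: orbC. Qed.

(* Iterated substitution into the two-coloring of K_5 by a pentagon and its
   complement; the base 5 digits of a vertex are its positions in the copies. *)
Fixpoint extremal_col (k i j : nat) : nat :=
  if k is k'.+2 then
    if i %% 5 == j %% 5 then extremal_col k' (i %/ 5) (j %/ 5)
    else k' + pentagon (i %% 5) (j %% 5)
  else 0.

Lemma nat_ind2 (P : nat -> Prop) :
  P 0 -> P 1 -> (forall k, P k -> P k.+2) -> forall k, P k.
Proof.
move=> P0 P1 PSS k; suff [] : P k /\ P k.+1 by [].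
by elim: k => // k [Pk PSk]; split=> //; exact: PSS.
Qed.

Lemma extremal_col_sym k i j : extremal_col k i j = extremal_col k j i.
Proof.
elim/nat_ind2: k i j => // k IH i j /=; rewrite eq_sym IH; case: eqP => // _.
by rewrite pentagonC.
Qed.

Lemma neq_div5 i j : i != j -> i %% 5 = j %% 5 -> i %/ 5 != j %/ 5.
Proof.
by move=> ij e; apply: contraNneq ij => e';
  rewrite (divn_eq i 5) (divn_eq j 5) e e'.
Qed.

Lemma ltn_div5 k i : i < gallai_size k.+2 -> i %/ 5 < gallai_size k.
Proof. by rewrite gallai_sizeSS mulnC -ltn_divLR. Qed.

(** In the step to [k.+2], vertices with different last digits get color [k] or [k.+1], the others a
    color below [k] by induction. *)
Lemma extremal_col_lt k i j :
  i < gallai_size k -> j < gallai_size k -> i != j -> extremal_col k i j < k.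
Proof.
elim/nat_ind2: k i j => [[|i] [|j]|[|[|i]] [|[|j]]|k IH i j] //.
move=> /ltn_div5 hi /ltn_div5 hj ij /=; case: eqP => [e|_].
  by apply: (@leq_trans k); [apply: IH => //; exact: neq_div5|lia].
by case: pentagon => /=; lia.
Qed.

(** If exactly two last digits agree, the edges to the third vertex have equal colors; if all
    differ, only two colors are available. *)
Lemma extremal_col_gallai k : gallai_on (extremal_col k) predT.
Proof.
elim/nat_ind2: k => // k IH x y z _ _ _ xy yz xz /=.
have [exy|nxy] := eqVneq (x %% 5) (y %% 5).
  have [eyz|nyz] := eqVneq (y %% 5) (z %% 5).
    by rewrite exy eyz eqxx; apply: IH => //; apply: neq_div5; congruence.
  by rewrite exy (negPf nyz) eqxx !orbT.
have [eyz|nyz] := eqVneq (y %% 5) (z %% 5).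
  by rewrite -eyz (negPf nxy) eqxx !orbT.
have [exz|nxz] := eqVneq (x %% 5) (z %% 5).
  by rewrite -exz [pentagon (y %% 5) _]pentagonC eqxx.
by case: (pentagon _ _) (pentagon _ _) (pentagon _ _) => [] [] [];
  rewrite eqxx ?orbT.
Qed.

Lemma pentagon_trifree a b e : a < 5 -> b < 5 -> e < 5 ->
  a != b -> b != e -> a != e ->
  ~~ ((pentagon a b == pentagon b e) && (pentagon a b == pentagon a e)).
Proof.
by move: a b e => [|[|[|[|[|a]]]]] [|[|[|[|[|b]]]]] [|[|[|[|[|e]]]]].
Qed.

(** In the step to [k.+2], edges inside a copy have colors below [k] and edges between copies do
    not, so a monochromatic triangle would lie in one copy or in the coloring of K_5. *)
Lemma extremal_col_trifree k :
  trifree_on (extremal_col k) (fun i => i < gallai_size k).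
Proof.
elim/nat_ind2: k => [||k IH] x y z.
- by rewrite (_ : gallai_size 0 = 1) //=; lia.
- by rewrite (_ : gallai_size 1 = 2) //=; lia.
move=> /= /ltn_div5 hx /ltn_div5 hy /ltn_div5 hz xy yz xz.
have neq t u (b : bool) : t < gallai_size k -> u < gallai_size k ->
    t != u -> (extremal_col k t u == k + b) = false.
  move=> ht hu tu; apply: ltn_eqF; apply: leq_trans (leq_addr _ _).
  exact: extremal_col_lt.
have [exy|nxy] := eqVneq (x %% 5) (y %% 5).
  have [eyz|nyz] := eqVneq (y %% 5) (z %% 5).
    by rewrite exy eyz eqxx; apply: IH => //; apply: neq_div5; congruence.
  by rewrite neq // neq_div5.
have [eyz|nyz] := eqVneq (y %% 5) (z %% 5).
  by rewrite eq_sym neq // neq_div5.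
have [exz|nxz] := eqVneq (x %% 5) (z %% 5).
  by rewrite andbC eq_sym neq // neq_div5.
have := pentagon_trifree (ltn_pmod x _) (ltn_pmod y _) (ltn_pmod z _) nxy nyz
  nxz.
move=> /(_ isT isT isT).
by case: (pentagon _ _) (pentagon _ _) (pentagon _ _) => [] [] [];
  rewrite ?eqn_add2l.
Qed.

(** * Edge colorings of ['K_n] as functions on pairs of vertices *)

Lemma eq_set2 (T : finType) (x y x' y' : T) : x != y ->
  [set x; y] = [set x'; y'] -> (x = x' /\ y = y') \/ (x = y' /\ y = x').
Proof.
move=> xy e; have := set21 x y; have := set22 x y; rewrite e !inE.
move=> /orP[] /eqP ey /orP[] /eqP ex; rewrite ?ex ?ey ?eqxx // in xy *;
  by [left|right].
Qed.

Section EdgeColorings.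
Variables (n : nat).
Implicit Types (x y z : 'I_n) (e : edge 'K_n).

Lemma edge_pair e : exists p : 'I_n * 'I_n, (p.1 != p.2) && (val e == [set
  p.1; p.2]).
Proof.
by have /imsetP[p] := valP e; rewrite inE /= => pn ve; exists p;
  rewrite pn ve /=.
Qed.

Lemma mem_edge_set x y : x != y -> [set x; y] \in edge_set 'K_n.
Proof. by move=> xy; apply/imsetP; exists (x, y) => //; rewrite inE. Qed.

Lemma edge_exists x y : x != y -> exists e, val e = [set x; y].
Proof. by move=> /mem_edge_set h;
  exists (exist (fun e : {set 'K_n} => e \in edge_set 'K_n) _ h). Qed.

(** Symmetry makes the order in which [xchoose] lists the ends irrelevant. *)
Lemma coloring_of_fun k (d : 'I_n -> 'I_n ->
  'I_k) : (forall x y, d x y = d y x) ->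
  exists c : coloring k 'K_n,
    forall e x y, val e = [set x; y] -> c e = d x y.
Proof.
move=> d_sym.
exists [ffun e => d (xchoose (edge_pair e)).1 (xchoose (edge_pair e)).2].
move=> e x y ve; rewrite ffunE; set p := xchoose _.
have /andP[pn /eqP ep] : (p.1 != p.2) && (val e == [set p.1; p.2]).
  exact: (xchooseP (edge_pair e)).
by case: (@eq_set2 _ p.1 p.2 x y pn) => [|[-> ->]|[-> ->]]; rewrite -?ep.
Qed.

Definition triangle x y z : {set edge 'K_n} :=
  [set e | [|| val e == [set x; y], val e == [set y; z] | val e == [set x; z]]].

Lemma copy_K3E (f : 'I_3 -> 'I_n) :
  [set e : edge 'K_n | val e \in [set f @: h | h : {set 'I_3} in edge_set 'K_3]]
  = triangle (f (inord 0)) (f (inord 1)) (f (inord 2)).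
Proof.
set i0 : 'I_3 := inord 0; set i1 : 'I_3 := inord 1; set i2 : 'I_3 := inord 2.
have [n01 n12 n02] : [/\ i0 != i1, i1 != i2 & i0 != i2].
  by rewrite -!val_eqE /= !inordK.
have I3 (i : 'I_3) : [\/ i = i0, i = i1 | i = i2].
  by case: i => [[|[|[|i]]]] // h; [constructor 1|constructor 2|constructor 3];
     apply: val_inj; rewrite /= inordK.
have im i j : [set f i; f j] = f @: [set i; j] by rewrite imsetU1 imset_set1.
have me (i j : 'I_3) : i != j -> [set i; j] \in edge_set 'K_3.
  by move=> ij; apply/imsetP; exists (i, j) => //; rewrite inE.
apply/setP => e; rewrite !inE; apply/imsetP/or3P.
  move=> [h /imsetP[[i j]]]; rewrite inE /= => ij -> ->; rewrite -im.
  move: ij; case: (I3 i) => ->; case: (I3 j) => ->; rewrite ?eqxx // => _;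
    rewrite 1?[[set f i1; f i0]]setUC 1?[[set f i2; f i0]]setUC
      1?[[set f i2; f i1]]setUC ?eqxx;
    by [constructor 1|constructor 2|constructor 3].
by case=> /eqP ->; rewrite im; [exists [set i0; i1]|exists [set i1;
  i2]|exists [set i0; i2]];
  rewrite ?me.
Qed.

Lemma is_copy_K3P (F : {set edge 'K_n}) :
  reflect (exists x y z, [/\ x != y, y != z, x != z & F = triangle x y z])
          (is_copy 'K_3 F).
Proof.
apply: (iffP existsP) => [[f /and3P[/injectiveP inj _ /eqP ->]]|].
  exists (f (inord 0)), (f (inord 1)), (f (inord 2)); rewrite !(inj_eq inj).
  by rewrite -!val_eqE /= !inordK; split=> //; exact: copy_K3E.
move=> [x [y [z [xy yz xz ->]]]].
pose f : {ffun 'K_3 -> 'K_n} := [ffun i : 'I_3 => nth x [:: x; y; z] i].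
have inj : injective f.
  move=> i j; rewrite !ffunE => /eqP; rewrite nth_uniq ?ltn_ord //=.
    by move/eqP/val_inj.
  by rewrite !inE negb_or xy xz yz.
exists f; apply/and3P; split; first exact/injectiveP.
  by apply/forallP => i; apply/forallP => j; apply/implyP;
    rewrite /= (inj_eq inj).
by apply/eqP; rewrite (copy_K3E f) !ffunE !inordK.
Qed.

Variables (k : nat) (c : coloring k.+1 'K_n).

(* Junk value ord0 when x = y. *)
Definition pair_col x y : 'I_k.+1 :=
  odflt ord0 (omap c (insub [set x; y] : option (edge 'K_n))).

Lemma pair_colC x y : pair_col x y = pair_col y x.
Proof. by rewrite /pair_col setUC. Qed.

Lemma pair_colE e x y : val e = [set x; y] -> c e = pair_col x y.
Proof. by move=> ve; rewrite /pair_col -ve valK. Qed.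

Lemma rainbow_triangle x y z : x != y -> y != z -> x != z ->
  rainbow c (triangle x y z) =
  ~~ [|| pair_col x y == pair_col y z, pair_col x y == pair_col x z
       | pair_col y z == pair_col x z].
Proof.
move=> xy yz xz.
have [[e1 v1] [e2 v2] [e3 v3]] := And3 (edge_exists xy) (edge_exists yz)
  (edge_exists xz).
have ne (e e' : edge 'K_n) t : t \in val e -> t \notin val e' ->
  e == e' = false.
  by move=> te te'; apply: contraNF te' => /eqP <-.
have n12 : e1 == e2 = false.
  by apply: (ne _ _ x); rewrite ?v1 ?v2 !inE ?eqxx // negb_or xy.
have n13 : e1 == e3 = false.
  by apply: (ne _ _ y); rewrite ?v1 ?v3 !inE ?eqxx ?orbT // negb_or eq_sym xy.
have n23 : e2 == e3 = false.
  by apply: (ne _ _ y); rewrite ?v2 ?v3 !inE ?eqxx ?orbT // negb_or eq_sym xy.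
rewrite -(pair_colE v1) -(pair_colE v2) -(pair_colE v3) !negb_or.
have inT e : e \in triangle x y z = [|| e == e1, e == e2 | e == e3].
  by rewrite inE -v1 -v2 -v3 !val_eqE.
apply/forall_inP/and3P => [H|[h12 h13 h23] e].
  have ax a b : a \in triangle x y z -> b \in triangle x y z ->
    a == b = false ->
      c a != c b.
    move=> /H /forall_inP/(_ b) Hb bT ab; apply: contraFN ab.
    by move/implyP: (Hb bT); apply.
  by split; apply: ax; rewrite ?inT ?eqxx ?orbT.
rewrite inT => eT; apply/forall_inP => e'; rewrite inT => eT'; apply/implyP.
move: eT eT'; do 2 case/or3P => /eqP ->; rewrite ?eqxx //;
 by rewrite ?(negPf h12) ?(negPf h13) ?(negPf h23) 1?eq_sym
    ?(negPf h12) ?(negPf h13) ?(negPf h23).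
Qed.

Lemma monochromatic_triangle x y z : x != y -> y != z -> x != z ->
  monochromatic c (triangle x y z) =
  (pair_col x y == pair_col y z) && (pair_col x y == pair_col x z).
Proof.
move=> xy yz xz.
have [[e1 v1] [e2 v2] [e3 v3]] := And3 (edge_exists xy) (edge_exists yz)
  (edge_exists xz).
rewrite -(pair_colE v1) -(pair_colE v2) -(pair_colE v3).
have inT e : e \in triangle x y z = [|| e == e1, e == e2 | e == e3].
  by rewrite inE -v1 -v2 -v3 !val_eqE.
apply/forall_inP/andP => [H|[/eqP h12 /eqP h13] e].
  by split; [apply: (forall_inP (H e1 _) e2)|apply: (forall_inP (H e1 _) e3)];
    rewrite inT eqxx ?orbT.
rewrite inT => eT; apply/forall_inP => e'; rewrite inT => eT'.
by move: eT eT'; do 2 case/or3P => /eqP ->; rewrite -?h12 -?h13.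
Qed.

Lemma gallaiP : reflect (gallai_on pair_col predT) (gallai c).
Proof.
apply: (iffP existsPn) => [H x y z _ _ _ xy yz xz|H F].
  have := H (triangle x y z); rewrite rainbow_triangle //.
  rewrite (_ : is_copy _ _) ?negbK //.
  by apply/is_copy_K3P; exists x, y, z.
apply/negP => /andP[/is_copy_K3P[x [y [z [xy yz xz ->]]]]].
by rewrite rainbow_triangle // H.
Qed.

Lemma no_monochromatic_K3P :
  reflect (trifree_on pair_col predT) (~~ has_monochromatic_copy c 'K_3).
Proof.
apply: (iffP existsPn) => [H x y z _ _ _ xy yz xz|H F].
  have := H (triangle x y z); rewrite monochromatic_triangle //.
  rewrite (_ : is_copy _ _) //.
  by apply/is_copy_K3P; exists x, y, z.
apply/negP => /andP[/is_copy_K3P[x [y [z [xy yz xz ->]]]]].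
by rewrite monochromatic_triangle //; apply/negP; exact: H.
Qed.

(** These are the edges that [fNIM] counts for the triangle. *)
Definition nim e := ~~ in_rainbow_triangle c e && ~~ in_monochromatic_copy c
  'K_3 e.

Lemma nimP e : reflect (forall x y z, x != y -> y != z -> x != z ->
   e \in triangle x y z ->
   [|| pair_col x y == pair_col y z, pair_col x y == pair_col x z
     | pair_col y z == pair_col x z] &&
   ~~ ((pair_col x y == pair_col y z) && (pair_col x y == pair_col x z)))
  (nim e).
Proof.
apply: (iffP andP) => [[/existsPn nr /existsPn nm] x y z xy yz xz eT|H].
  have cp : is_copy 'K_3 (triangle x y z) by apply/is_copy_K3P; exists x, y, z.
  have := nr (triangle x y z); have := nm (triangle x y z).
  rewrite cp eT !andbT /= rainbow_triangle // monochromatic_triangle // negbK.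
  by move=> -> ->.
split; apply/existsPn => F;
  apply/negP => /and3P[/is_copy_K3P[x [y [z [xy yz xz ->]]]]].
  rewrite rainbow_triangle // => + eT; have /andP[-> _] := H x y z xy yz xz eT.
  by [].
rewrite monochromatic_triangle // => + eT.
by have /andP[_ /negPf->] := H x y z xy yz xz eT.
Qed.
End EdgeColorings.

Lemma GR_K3 k : GR k.+1 'K_3 = (gallai_size k.+1).+1.
Proof.
(* Every smaller [N] is excluded because [GR] is a minimum. *)
have no N : N <= gallai_size k.+1 -> ~~ gallai_ramsey_property k.+1 'K_3 N.
  move=> leN; rewrite /gallai_ramsey_property.
  pose d (i j : 'I_N) : 'I_k.+1 := inord (extremal_col k.+1 i j).
  have [c cE] : exists c : coloring k.+1 'K_N,
      forall e x y, val e = [set x; y] -> c e = d x y.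
    by apply: coloring_of_fun => x y; rewrite /d extremal_col_sym.
  have lt (i : 'I_N) : i < gallai_size k.+1 by apply: leq_trans leN.
  have pE (x y : 'I_N) : x != y ->
    pair_col c x y = extremal_col k.+1 x y :> nat.
    move=> xy; have [e ve] := edge_exists xy;
      rewrite -(pair_colE c ve) (cE _ _ _ ve).
    by rewrite inordK // extremal_col_lt.
  apply/forallPn; exists c; rewrite negb_imply; apply/andP; split.
    apply/gallaiP => x y z _ _ _ xy yz xz; rewrite -!val_eqE /= !pE //.
    exact: extremal_col_gallai.
  apply/no_monochromatic_K3P => x y z _ _ _ xy yz xz;
    rewrite -!val_eqE /= !pE //.
  by apply: extremal_col_trifree; rewrite ?lt.
have yes : gallai_ramsey_property k.+1 'K_3 (gallai_size k.+1).+1.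
  apply/forallP => c; apply/implyP => /gallaiP gc; apply: contraT.
  move=> /no_monochromatic_K3P tc.
  have := @gallai_card_le _ _ _ (pair_colC c) setT k.+1.
  rewrite cardsT card_ord ltnn; apply.
  - by move=> x y z _ _ _; exact: gc.
  - by move=> x y z _ _ _; exact: tc.
  - by move=> v _; rewrite -[leqRHS]card_ord max_card.
rewrite /GR; case: pselect => [ex|[]]; last by exists (gallai_size k.+1).+1.
case: ex_minnP => N yN minN; apply/eqP; rewrite eqn_leq minN //=.
by rewrite ltnNge; apply/negP => /no; rewrite yN.
Qed.

(** * Lower bound by a blow-up of the extremal coloring *)

Lemma turan_le_fNIM k n : turan n (gallai_size k.+1) <= fNIM k.+2 n 'K_3.
Proof.
set r := gallai_size k.+1.
have lt (i : 'I_n) : i %% r < r by rewrite ltn_pmod // gallai_size_gt0.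
pose d (i j : 'I_n) : 'I_k.+2 :=
  if i %% r == j %% r then ord_max else inord (extremal_col k.+1 (i %% r) (j
    %% r)).
have [c cE] : exists c : coloring k.+2 'K_n,
    forall e x y, val e = [set x; y] -> c e = d x y.
  by apply: coloring_of_fun => x y; rewrite /d extremal_col_sym eq_sym.
have pE (x y : 'I_n) : x != y -> pair_col c x y =
    (if x %% r == y %% r then k.+1 else extremal_col k.+1 (x %% r) (y %% r))
      :> nat.
  move=> xy; have [e ve] := edge_exists xy;
    rewrite -(pair_colE c ve) (cE _ _ _ ve) /d.
  case: eqP => // /eqP ne; rewrite inordK // ltnS ltnW //.
  by apply: extremal_col_lt; rewrite ?lt.
have neq (x y : 'I_n) : x %% r != y %% r ->
    (extremal_col k.+1 (x %% r) (y %% r) == k.+1) = false.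
  by move=> ne; apply: ltn_eqF; apply: extremal_col_lt; rewrite ?lt.
have sub : edge_set (turan_graph n r) \subset
    val @: [set e : edge 'K_n | nim c e].
  apply/subsetP => X /imsetP[[i j]]; rewrite inE /= => ij eX.
  have nij : i != j by apply: contraNneq ij => ->.
  have [e ve] := edge_exists nij.
  apply/imsetP; exists e; last by rewrite eX ve.
  rewrite inE; apply/nimP => x y z xy yz xz.
  have cross a b : val e = [set a; b] -> a %% r != b %% r.
    by rewrite ve => /(eq_set2 nij)[] [<- <-] //; rewrite eq_sym.
  rewrite !inE => eT.
  have eT' : [|| x %% r != y %% r, y %% r != z %% r | x %% r != z %% r].
    by case/or3P: eT => /eqP/cross->; rewrite ?orbT.
  rewrite -!val_eqE /= !pE //.
  (* With exactly two vertices in one class, one edge has the extra color and the other two share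
     another color. Across three classes the triangle is one of [extremal_col]. *)
  move: eT'; have [exy|nxy] := eqVneq (x %% r) (y %% r).
    rewrite exy /=; have [//|nyz _] := eqVneq (y %% r) (z %% r).
    by rewrite eqxx !orbT eq_sym neq.
  have [eyz _|nyz _] := eqVneq (y %% r) (z %% r).
    by rewrite -eyz (negPf nxy) eqxx !orbT neq.
  have [exz|nxz] := eqVneq (x %% r) (z %% r).
    by rewrite -exz extremal_col_sym eqxx neq // eq_sym.
  apply/andP; split; first exact: extremal_col_gallai.
  by apply: extremal_col_trifree; rewrite ?lt.
apply: leq_trans (subset_leq_card sub) _; rewrite card_imset;
  last exact: val_inj.
exact: (leq_bigmax (F := fun c : coloring k.+2 'K_n => #|[set e | nim c e]|) c).
Qed.

(** * Boxes in dense sets of tuples *)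

Section TupleCount.
Variable V : finType.
Implicit Types (E F : pred (seq V)) (m : nat).

(** Counts the [m]-tuples in [E]; recursion on the first coordinate allows inequalities to be proved
    one coordinate at a time. *)
Fixpoint cnt m E : nat :=
  if m is m'.+1 then \sum_(u : V) cnt m' (fun z => E (u :: z)) else E [::].

Lemma eq_cnt m E F : E =1 F -> cnt m E = cnt m F.
Proof.
elim: m E F => [|m IH] E F EF /=; first by rewrite EF.
by apply: eq_bigr => u _; apply: IH => z; exact: EF.
Qed.

Lemma cnt_le m E : cnt m E <= #|V| ^ m.
Proof.
elim: m E => [|m IH] E /=; first by case: (E _).
by rewrite expnS -sum_nat_const; apply: leq_sum => u _; exact: IH.
Qed.

Lemma cnt_partition (P : finType) (f : seq V -> P) m E :
  cnt m E = \sum_(p : P) cnt m (fun z => E z && (f z == p)).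
Proof.
elim: m E f => [|m IH] E f /=.
  case: (E _) => /=; last by rewrite big1.
  by rewrite (bigD1 (f [::])) //= eqxx big1 // => p /negPf;
    rewrite eq_sym => ->.
rewrite exchange_big /=; apply: eq_bigr => u _.
exact: (IH (fun z => E (u :: z)) (fun z => f (u :: z))).
Qed.

Local Open Scope ring_scope.
Variable R : realFieldType.

(** Cauchy-Schwarz, by expanding the nonnegative sum of the squares of [#|I| * a i - S]. *)
Lemma sqr_sum_le (I : finType) (a : I -> R) :
  (\sum_i a i) ^+ 2 <= #|I|%:R * \sum_i a i ^+ 2.
Proof.
have [I0|I_gt0] := posnP #|I|.
  rewrite I0 mul0r big1 ?expr0n // => i _.
  by move: (fintype0 i I0).
set S := \sum_i a i.
have : 0 <= \sum_i (#|I|%:R * a i - S) ^+ 2 by apply: sumr_ge0 => i _;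
  rewrite sqr_ge0.
rewrite (eq_bigr (fun i => #|I|%:R ^+ 2 * a i ^+ 2 - 2 * #|I|%:R * S * a i + S
  ^+ 2)).
  rewrite big_split sumrB /= sumr_const -[S ^+ 2 *+ _]mulr_natl -!mulr_sumr -/S.
  rewrite (_ : _ + _ = #|I|%:R * (#|I|%:R * \sum_i a i ^+ 2 - S ^+ 2));
    last by ring.
  by rewrite pmulr_rge0 ?ltr0n // subr_ge0.
by move=> i _; ring.
Qed.

(** Cauchy-Schwarz over the tuples [z], applied to the number of [u] with [F u z]; the square of
    this number counts pairs [u], [u']. *)
Lemma sqr_sum_cnt_le (U : finType) m (F : U -> pred (seq V)) :
  (\sum_u (cnt m (F u))%:R) ^+ 2 <=
  #|V|%:R ^+ m * \sum_u \sum_u' (cnt m (fun z => F u z && F u' z))%:R :> R.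
Proof.
elim: m F => [|m IH] F /=.
  rewrite expr0 mul1r expr2 mulr_suml; apply: ler_sum => u _.
  rewrite mulr_sumr; apply: ler_sum => u' _.
  by rewrite -natrM mulnb.
under eq_bigr do rewrite natr_sum.
rewrite exchange_big /=; apply: le_trans (sqr_sum_le _) _.
rewrite exprS -mulrA ler_wpM2l ?ler0n //.
apply: le_trans (ler_sum _ (fun v _ => IH (fun u z => F u (v :: z)))) _.
rewrite -mulr_sumr ler_wpM2l ?exprn_ge0 ?ler0n //.
rewrite exchange_big /=; apply: ler_sum => u _.
by rewrite exchange_big /=; apply: ler_sum => u' _; rewrite natr_sum.
Qed.
End TupleCount.

Definition mix (V : finType) (b : seq bool) (x : seq (V * V)) : seq V :=
  [seq if p.1 then p.2.1 else p.2.2 | p <- zip b x].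

Section BoxTheorem.
Local Open Scope ring_scope.

(* Erdős' theorem on complete m-partite m-graphs with parts of size 2, by
   applying the Cauchy-Schwarz inequality to one coordinate at a time. *)
Lemma box_exists (R : archiRealFieldType) m (eps : R) : 0 < eps ->
  exists n0, forall (V : finType) (E : pred (seq V)), (n0 <= #|V|)%N ->
    eps * #|V|%:R ^+ m <= (cnt m E)%:R ->
  exists x : seq (V * V), [/\ size x = m, all (fun p => p.1 != p.2) x &
    forall b, size b = m -> E (mix b x)].
Proof.
elim: m eps => [|m IH] eps eps_gt0.
  exists 0%N => V E _; rewrite expr0 mulr1 /= => le.
  exists [::]; split=> // -[] // _; apply: contraLR le => /negPf->.
  by rewrite -ltNge.
have e2_gt0 : 0 < eps ^+ 2 / 2 by rewrite divr_gt0 ?exprn_gt0.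
have [n1 IHn] := IH _ e2_gt0.
(* The second bound ensures [eps^2 / 2 * n > 1], which makes the diagonal pairs [u = u']
   negligible. *)
exists (maxn n1 (Num.bound (eps ^+ 2 / 2)^-1)) => V E; rewrite geq_max.
set n := #|V| => /andP[n1n bn] le.
pose c u u' := cnt m (fun z : seq V => E (u :: z) && E (u' :: z)).
have big_n : 1 < eps ^+ 2 / 2 * n%:R.
  rewrite mulrC -ltr_pdivrMr // mul1r.
  apply: lt_le_trans (archi_boundP _) _; first by rewrite invr_ge0 ltW.
  by rewrite ler_nat.
have n_gt0 : 0 < n%:R :> R by rewrite lt0r ler0n andbT;
  apply: contraTneq big_n => ->; rewrite mulr0 ltr10.
have nm_gt0 : 0 < n%:R ^+ m :> R by rewrite exprn_gt0.
have lower : eps ^+ 2 * n%:R ^+ 2 * n%:R ^+ m <=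
  \sum_u \sum_u' (c u u')%:R :> R.
  have := sqr_sum_cnt_le R m (fun u z => E (u :: z)).
  rewrite -natr_sum -/n -ler_pdivrMl // => /(le_trans _); apply.
  rewrite ler_pdivlMl //; apply: (@le_trans _ _ ((eps * n%:R ^+ m.+1) ^+ 2)).
    by rewrite [_ ^+ m.+1]exprS le_eqVlt; apply/orP; left; apply/eqP; ring.
  by apply: lerXn2r => //; rewrite nnegrE ?ler0n // mulr_ge0 ?exprn_ge0 ?ler0n
    // ltW.
(* A pair with many common extensions becomes the first side of the box. Without one, the diagonal
   contributes at most [n^(m+1)] and the rest at most half of [lower]. *)
have [/existsP[u /existsP[u' /andP[uu' cu]]]|none] :=
    boolP [exists u, exists u', (u != u') && (eps ^+ 2 / 2 * n%:R ^+ m <=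
      (c u u')%:R)].
  have [x [sx dx Ex]] := IHn V _ n1n cu.
  exists ((u, u') :: x); split=> [||[//|b bs] [sb]] /=; rewrite ?sx ?uu' //.
  by have /andP[] := Ex bs sb; rewrite /mix /=; case: b.
have upper : \sum_u \sum_u' (c u u')%:R <=
    \sum_(u : V) \sum_(u' : V) ((u == u')%:R * n%:R ^+ m + eps ^+ 2 / 2 * n%:R
      ^+ m) :> R.
  apply: ler_sum => u _; apply: ler_sum => u' _.
  have [e|ne] := eqVneq u u'.
    rewrite mul1r -[leLHS]addr0; apply: lerD;
      first by rewrite -natrX ler_nat cnt_le.
    by rewrite mulr_ge0 // ltW.
  rewrite mul0r add0r ltW // ltNge; apply: contraNN none => h.
  by apply/existsP; exists u; apply/existsP; exists u'; rewrite ne.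
have := le_trans lower upper.
have sum1 (u : V) : \sum_(u' : V) ((u == u')%:R * n%:R ^+ m + eps ^+ 2 / 2 *
  n%:R ^+ m)
    = n%:R ^+ m * (1 + eps ^+ 2 / 2 * n%:R) :> R.
  rewrite big_split /= -mulr_suml (bigD1 u) //= eqxx big1 ?addr0; last first.
    by move=> u' /negPf; rewrite eq_sym => ->.
  by rewrite sumr_const -[(eps ^+ 2 / 2 * _) *+ _]mulr_natl -/n /=; ring.
under eq_bigr do rewrite sum1.
rewrite sumr_const -[(n%:R ^+ m * _) *+ _]mulr_natl -/n => {}le; exfalso.
move: le; apply/negP; rewrite -ltNge.
rewrite -subr_gt0 (_ : _ - _ = n%:R ^+ m * n%:R * (eps ^+ 2 / 2 * n%:R - 1));
  last by field.
by rewrite !mulr_gt0 // subr_gt0.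
Qed.
End BoxTheorem.

(** * Cliques in dense graphs *)

Section DenseCore.
Variables (V : finType) (adj : rel V).
Hypotheses (adj_sym : symmetric adj).
Implicit Types (A : {set V}) (u v : V) (p : seq V).

Definition deg A v := #|[set u in A | adj v u]|.

Definition pairs A := \sum_(v in A) deg A v.

Lemma pairsD1 A v : v \in A -> pairs A <= pairs (A :\ v) + 2 * deg A v.
Proof.
move=> vA; rewrite /pairs (big_setD1 v) //=.
have degD u : deg A u = adj u v + deg (A :\ v) u.
  rewrite /deg (cardsD1 v) inE vA /=; congr (_ + #|pred_of_set _|).
  by apply/setP => w; rewrite !inE andbA.
under [X in _ + X <= _]eq_bigr do rewrite degD.
have : \sum_(u in A :\ v) (adj u v : nat) <= deg A v.
  have -> : \sum_(u in A :\ v) (adj u v : nat) = #|[set u in A :\ v | adj u v]|.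
    by rewrite -sum1dep_card big_mkcondr; apply: eq_bigr => u _; case: adj.
  apply: subset_leq_card; apply/subsetP => u.
  by rewrite !inE adj_sym => /andP[/andP[_ ->] ->].
by rewrite big_split /=; lia.
Qed.

Lemma pairs_le A : pairs A <= #|A| ^ 2.
Proof.
rewrite expnS expn1 -sum_nat_const; apply: leq_sum => v _.
by apply: subset_leq_card; apply/subsetP => u; rewrite inE => /andP[].
Qed.

(** Each [v] in [p] excludes at most [#|A| - deg A v] vertices of [A]; the terms are arranged to
    avoid subtraction. *)
Lemma common_card A p : {subset p <= A} ->
  #|A| + \sum_(v <- p) deg A v <=
  #|[set u in A | all (adj u) p]| + size p * #|A|.
Proof.
elim: p => [|v p IH] sp.
  rewrite big_nil !addn0; apply: subset_leq_card.
  by apply/subsetP => u; rewrite inE andbT.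
rewrite big_cons /= mulSn.
have : {subset p <= A} by move=> u up; apply: sp; rewrite inE up orbT.
move=> /IH {IH}; set X := [set u in A | all _ p] => le.
have sub : X :|: [set u in A | adj v u] \subset A.
  by apply/subsetP => u; rewrite !inE => /orP[] /andP[].
have -> : [set u in A | adj u v && all (adj u) p] = X :&: [set u in A | adj v
  u].
  by apply/setP => u; rewrite !inE adj_sym;
    case: (u \in A) (adj v u) (all _ _) => [] [] [].
have := subset_leq_card sub; have := cardsUI X [set u in A | adj v u].
rewrite -/(deg A v); lia.
Qed.

Local Open Scope ring_scope.
Variable R : realFieldType.

(* Deleting a vertex of small degree increases e(A) - alpha |A|^2. *)
Lemma dense_core (alpha eta : R) : 0 <= alpha ->
  (alpha + eta) * #|V|%:R ^+ 2 <= (pairs setT)%:R ->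
  exists A, eta * #|V|%:R ^+ 2 <= #|A|%:R ^+ 2 /\
    forall v, v \in A -> alpha * (#|A|%:R - 1 / 2) <= (deg A v)%:R.
Proof.
move=> alpha0 dense; pose phi A : R := (pairs A)%:R - alpha * #|A|%:R ^+ 2.
have [A _ maxA] : exists2 A, true & forall B, phi B <= phi A.
  by have [A _ H] := @arg_maxP _ _ _ setT xpredT phi isT; exists A => // B;
    exact: H.
exists A; split.
  (* Comparison with [setT] gives [phi A >= eta * #|V|^2]. *)
  have := maxA setT; rewrite /phi cardsT.
  have : (pairs A)%:R <= #|A|%:R ^+ 2 :> R by rewrite -natrX ler_nat pairs_le.
  have : 0 <= alpha * #|A|%:R ^+ 2 by rewrite mulr_ge0 ?sqr_ge0.
  by move: dense; rewrite mulrDl; lra.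
(* Here [2 * deg A v >= alpha * (#|A|^2 - (#|A| - 1)^2)], whence the 1/2. *)
move=> v vA; have := maxA (A :\ v); rewrite /phi.
have : (pairs A)%:R <= (pairs (A :\ v))%:R + 2 * (deg A v)%:R :> R.
  by rewrite -natrM -natrD ler_nat pairsD1.
have -> : #|A|%:R = #|A :\ v|%:R + 1 :> R by rewrite natr1 (cardsD1 v A) vA.
by nra.
Qed.

(** Greedy extension: there are at least [x] choices for each of the [m] new vertices. *)
Lemma clique_count A (x : R) m p : 0 <= x -> {subset p <= A} ->
  pairwise adj p ->
  (forall q, {subset q <= A} -> (size q < size p + m)%N ->
     x <= #|[set u in A | all (adj u) q]|%:R) ->
  x ^+ m <= (cnt m (fun z => pairwise adj (p ++ z)))%:R.
Proof.
move=> x0; elim: m p => [|m IH] p sp pp large /=; first by rewrite cats0 pp.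
apply: (@le_trans _ _ (\sum_(u in [set u in A | all (adj u) p]) x ^+ m)).
  rewrite sumr_const -[leRHS]mulr_natl exprS ler_wpM2r ?exprn_ge0 //.
  by apply: large => //; rewrite addnS ltnS leq_addr.
rewrite natr_sum [leRHS](bigID (mem [set u in A | all (adj u) p])) /=.
rewrite -[leLHS]addr0 lerD ?sumr_ge0 //; apply: ler_sum => u;
  rewrite inE => /andP[uA up].
under eq_cnt do rewrite -cat_rcons.
apply: IH.
- by move=> w; rewrite mem_rcons inE => /predU1P[->|/sp].
- by rewrite -cats1 pairwise_cat pp /= andbT /allrel; apply/allP => w wp /=;
    rewrite adj_sym (allP up w wp).
- by rewrite size_rcons addSnnS.
Qed.

(** In the dense core [A], any at most [r] vertices have at least [eta / 2 * #|A|] common neighbors,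
    so cliques can be grown greedily to [r.+1] vertices. *)
Lemma many_cliques (r : nat) (eta : R) : (0 < r)%N -> 0 < eta -> eta <= 1 ->
  (1 - r%:R^-1 + 2 * eta) * #|V|%:R ^+ 2 <= (pairs setT)%:R ->
  2 <= eta ^+ 2 * #|V|%:R ->
  (eta ^+ 2 / 2 * #|V|%:R) ^+ r.+1 <= (cnt r.+1 (pairwise adj))%:R.
Proof.
move=> r_gt0 eta0 eta1 dense big.
have r0 : 0 < r%:R :> R by rewrite ltr0n.
have ri : r%:R^-1 <= 1 :> R by rewrite invf_le1 // ler1n.
have ir : r%:R * r%:R^-1 = 1 :> R by rewrite divff // gt_eqF.
have [||A [Abig degA]] := @dense_core (1 - r%:R^-1 + eta) eta; first lra.
  by apply: le_trans dense; rewrite le_eqVlt; apply/orP; left; apply/eqP; ring.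
have n0 : 0 < #|V|%:R :> R.
  by rewrite lt0r ler0n andbT; apply: contraTneq big => ->;
    rewrite mulr0 -ltNge ltr0n.
have An : #|A|%:R <= #|V|%:R :> R by rewrite ler_nat max_card.
have A_ge : eta * #|V|%:R <= #|A|%:R.
  rewrite -(ler_pM2r n0); have := ler0n R #|A|; nra.
have etaA : 2 <= eta * #|A|%:R by apply: le_trans big _; nra.
have A2 : 2 <= #|A|%:R :> R by have := ler0n R #|A|; nra.
have le : eta ^+ 2 / 2 * #|V|%:R <= eta / 2 * #|A|%:R by nra.
apply: (@le_trans _ _ ((eta / 2 * #|A|%:R) ^+ r.+1)).
  by apply: lerXn2r => //; rewrite nnegrE; nra.
apply: (@clique_count A _ r.+1 [::]) => //; first nra.
move=> q sq; rewrite add0n ltnS => qr.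
have := common_card sq; rewrite -(ler_nat R) !natrD natr_sum natrM.
have deg_sum : (size q)%:R * ((1 - r%:R^-1 + eta) * (#|A|%:R - 1 / 2)) <=
    \sum_(v <- q) (deg A v)%:R.
  elim: q sq {qr} => [|v q IH] sq; first by rewrite big_nil mul0r.
  rewrite big_cons /= -[_.+1%:R]nat1r mulrDl mul1r. apply: lerD.
    by apply: degA; apply: sq; rewrite mem_head.
  by apply: IH => w wq; apply: sq; rewrite inE wq orbT.
have : (size q)%:R <= r%:R :> R by rewrite ler_nat.
have : 0 <= (size q)%:R :> R by [].
move: deg_sum; set s := (size q)%:R; set a := #|A|%:R in etaA A2 *.
set C := #|_|%:R; set S := \sum_(v <- q) _ => degS s0 sr HC.
have ra : r%:R * (1 - r%:R^-1 + eta) = r%:R - 1 + r%:R * eta.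
  by rewrite mulrDr mulrBr ir mulr1.
have r1 : 1 <= r%:R :> R by rewrite ler1n.
have loss : r%:R * (a - (1 - r%:R^-1 + eta) * (a - 1 / 2)) <= a - eta / 2 * a.
  rewrite mulrBr mulrA ra.
  have h1 : eta * a <= r%:R * (eta * a) by rewrite ler_peMl //; lra.
  have h2 : r%:R * 2 <= r%:R * (eta * a) by rewrite ler_pM2l.
  have h3 : r%:R * eta <= r%:R * 1 by rewrite ler_pM2l.
  lra.
have : s * (a - (1 - r%:R^-1 + eta) * (a - 1 / 2)) <= a - eta / 2 * a.
  (* The bound on the loss per vertex may be negative; then [s <= r] gives nothing, but the product
     is at most 0. *)
  have [pos|neg] := leP 0 (a - (1 - r%:R^-1 + eta) * (a - 1 / 2)).
    by apply: le_trans loss; rewrite ler_wpM2r.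
  apply: (@le_trans _ _ 0); first by rewrite mulr_ge0_le0 // ltW.
  by nra.
by rewrite mulrBr; lra.
Qed.
End DenseCore.

(** * Edge counts and the size of the Turán graph *)

Lemma card_adj (G : sgraph) : #|[set p : G * G | adj p.1 p.2]| = 2 *
  #|edge_set G|.
Proof.
rewrite -sum1_card (partition_big (fun p : G * G => [set p.1;
  p.2]) (mem (edge_set G))) /=;
  last first.
  by move=> p; rewrite inE => pa; apply/imsetP; exists p; rewrite ?inE.
rewrite mulnC -sum_nat_const; apply: eq_bigr => e /imsetP[[x y]];
  rewrite inE /= => xy ->.
have nxy : x != y by apply: contraTneq xy => ->; rewrite adj_irr.
rewrite sum1dep_card (_ : [set _ | _] = [set (x, y);
  (y, x)]) ?cards2 ?xpair_eqE.
  by rewrite (negPf nxy).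
apply/setP => -[u v]; rewrite !inE /= !xpair_eqE; apply/andP/orP.
  move=> [uv /eqP/(@eq_set2 _ u v x y)].
  have nuv : u != v by apply: contraTneq uv => ->; rewrite adj_irr.
  by case=> // -[-> ->]; rewrite !eqxx; [left|right].
by case=> /andP[/eqP-> /eqP->]; split=> //; rewrite 1?adj_sym // setUC.
Qed.

Lemma card_residue n r (a : nat) : #|[set j : 'I_n | a == j %% r]| <=
  (n %/ r).+1.
Proof.
rewrite -[leqRHS]card_ord.
pose f (j : 'I_n) : 'I_(n %/ r).+1 := inord (j %/ r).
rewrite -(@card_in_imset _ _ f); first exact: max_card.
move=> i j; rewrite !inE => /eqP ei /eqP ej /(congr1 val) /=.
have lt (l : 'I_n) : l %/ r < (n %/ r).+1 by rewrite ltnS leq_div2r // ltnW.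
rewrite !inordK // => e; apply: val_inj => /=.
by rewrite (divn_eq i r) (divn_eq j r) e -ei -ej.
Qed.

(** Each vertex shares its class with at most [(n %/ r).+1] vertices, itself included. The error
    linear in [n] is later absorbed by [delta * n^2]. *)
Lemma turan_lower n r : n ^ 2 <= 2 * turan n r + n * (n %/ r).+1.
Proof.
rewrite -card_adj -[n ^ 2]/(n * n) -{1 2}[n]card_ord -card_prod.
rewrite -(cardsC [set p : 'I_n * 'I_n | p.1 %% r != p.2 %% r]) leq_add2l.
rewrite (_ : ~: _ = [set p : 'I_n * 'I_n | p.1 %% r == p.2 %% r]); last first.
  by apply/setP => p; rewrite !inE negbK.
have -> : #|[set p : 'I_n * 'I_n | p.1 %% r == p.2 %% r]| =
    \sum_(i < n) \sum_(j < n | i %% r == j %% r) 1.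
  by rewrite pair_big_dep /= sum1dep_card.
rewrite -[X in _ <= X * _]card_ord -sum_nat_const; apply: leq_sum => i _.
by rewrite sum1dep_card card_residue.
Qed.

(** * The graph of the edges in no rainbow or monochromatic triangle *)

Section NimGraph.
Variables (k n : nat) (c : coloring k.+1 'K_n).

(** [insub] fails on [[set x; x]], so there are no loops. *)
Definition nim_adj : rel 'I_n := fun x y =>
  if insub [set x; y] : option (edge 'K_n) is Some e then nim c e else false.

Lemma nim_adj_sym : symmetric nim_adj.
Proof. by move=> x y; rewrite /nim_adj setUC. Qed.

Lemma nim_adjP x y : nim_adj x y ->
  x != y /\ exists2 e : edge 'K_n, val e = [set x; y] & nim c e.
Proof.
rewrite /nim_adj; case: insubP => // e _ ve ne; split; last by exists e.
have [p /andP[pn /eqP ep]] := edge_pair e.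
rewrite ep in ve; by case: (eq_set2 pn ve) => -[<- <-] //; rewrite eq_sym.
Qed.

Lemma nim_adj_irr : irreflexive nim_adj.
Proof. by move=> x; apply/negP => /nim_adjP[]; rewrite eqxx. Qed.

Lemma nim_pairs : 2 * #|[set e : edge 'K_n | nim c e]| <= pairs nim_adj setT.
Proof.
have -> : pairs nim_adj setT = #|[set p : 'I_n * 'I_n | nim_adj p.1 p.2]|.
  have -> : #|[set p : 'I_n * 'I_n | nim_adj p.1 p.2]| =
      \sum_(i < n) \sum_(j < n | nim_adj i j) 1.
    by rewrite pair_big_dep /= sum1dep_card.
  rewrite /pairs; apply: eq_big => i; first by rewrite inE.
  by rewrite sum1dep_card => _; congr #|pred_of_set _|; apply/setP => j;
    rewrite !inE.
rewrite (card_adj (SGraph nim_adj_sym nim_adj_irr)) leq_pmul2l //.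
rewrite -(card_imset _ val_inj); apply: subset_leq_card.
apply/subsetP => X /imsetP[e]; rewrite inE => ne eX.
have [p /andP[pn /eqP ep]] := edge_pair e.
apply/imsetP; exists p; last by rewrite eX ep.
by rewrite inE /= /nim_adj -ep valK.
Qed.

(* The doubled clique (x_i, y_i) induces a Gallai coloring of 'I_m without
   monochromatic triangles, in which the color of x_i y_i is missing at i. *)
Lemma nim_box m (p : {ffun 'I_m * 'I_m ->
  'I_k.+1}) (x0 : 'I_n) (x : seq ('I_n * 'I_n)) :
  size x = m -> all (fun p => p.1 != p.2) x ->
  (forall b, size b = m -> pairwise nim_adj (mix b x) /\
    forall i j : 'I_m, p (i, j) = pair_col c (nth x0 (mix b x) i) (nth x0 (mix
      b x) j)) ->
  m <= gallai_size k.
Proof.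
move=> sx dx Hx.
pose s (i : 'I_m) (b : bool) := let q := nth (x0, x0) x i in if b then q.1
  else q.2.
have mixE (B : nat -> bool) (i : 'I_m) : nth x0 (mix (mkseq B m) x) i = s i (B
  i).
  rewrite /mix (nth_map (false, (x0, x0)));
    last by rewrite size_zip size_mkseq sx minnn.
  by rewrite nth_zip ?size_mkseq // nth_mkseq.
have adjs (i j : 'I_m) a b : i != j ->
  nim_adj (s i a) (s j b) /\ pair_col c (s i a) (s j b) = p (i, j).
  (* A corner of the box with the prescribed bits at [i] and [j]. *)
  move=> ij; pose B (t : nat) := if t == i then a else b.
  have Bi : B i = a by rewrite /B eqxx.
  have Bj : B j = b by rewrite /B val_eqE eq_sym (negPf ij).
  have [pw pE] := Hx (mkseq B m) (size_mkseq _ _).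
  split; last by rewrite pE !mixE Bi Bj.
  have lt (t : 'I_m) : (t : nat) \in [pred u | u < size (mix (mkseq B m) x)].
    by rewrite inE size_map size_zip size_mkseq sx minnn.
  have /(pairwiseP x0) H := pw.
  rewrite -Bi -Bj -!mixE; case: (ltngtP i j) => [lij|lji|e].
  - exact: H.
  - by rewrite nim_adj_sym; exact: H.
  - by move: ij; rewrite -val_eqE /= e eqxx.
pose d (i j : 'I_m) := p (i, j).
have good (i j l : 'I_m) : i != j -> j != l -> i != l ->
    [|| d i j == d j l, d i j == d i l | d j l == d i l] &&
    ~~ ((d i j == d j l) && (d i j == d i l)).
  move=> ij jl il.
  have [/nim_adjP[n1 [e ve /nimP ne]] E1] := adjs i j true true ij.
  have [/nim_adjP[n2 _] E2] := adjs j l true true jl.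
  have [/nim_adjP[n3 _] E3] := adjs i l true true il.
  rewrite /d -E1 -E2 -E3; apply: ne => //.
  by rewrite inE ve eqxx.
have d_sym i j : d i j = d j i.
  have [->//|ij] := eqVneq i j; have ji : j != i by rewrite eq_sym.
  by rewrite /d -(adjs i j true true ij).2 -(adjs j i true true ji).2 pair_colC.
have := @gallai_card_le _ _ d d_sym setT k; rewrite cardsT card_ord; apply.
- by move=> i j l _ _ _ ij jl il; have /andP[] := good i j l ij jl il.
- by move=> i j l _ _ _ ij jl il; have /andP[] := good i j l ij jl il.
move=> i _; rewrite -ltnS -[X in _ < X]card_ord -cardsT; apply: proper_card.
apply/properP; split; first exact: subsetT.
exists (pair_col c (s i true) (s i false)); first by rewrite inE.
(* Otherwise [s i true], [s i false] and [s j true] form a monochromatic triangle containing a [nim]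
   edge. *)
apply/imsetP => -[j /setD1P[ji _] ec]; have ij : i != j by rewrite eq_sym.
have [/nim_adjP[n1 [e ve /nimP ne]] E1] := adjs i j true true ij.
have [/nim_adjP[n2 _] E2] := adjs i j false true ij.
have n3 : s i true != s i false.
  by move/all_nthP: dx => /(_ (x0, x0) i); rewrite sx; apply.
have := ne _ _ _ n3 n2 n1; rewrite inE ve eqxx !orbT => /(_ isT).
by rewrite E1 E2 ec /d !eqxx andbF.
Qed.
End NimGraph.

(** * Upper bound by supersaturation and boxes with a constant color pattern *)

Local Open Scope ring_scope.

Lemma fNIM_upper (R : archiRealFieldType) k (delta : R) : 0 < delta ->
  exists n0, forall n, (n0 <= n)%N -> forall c : coloring k.+1 'K_n,
    #|[set e : edge 'K_n | nim c e]|%:R <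
    (turan n (gallai_size k))%:R + delta * n%:R ^+ 2.
Proof.
move=> delta0; set r := gallai_size k.
have r_gt0 : (0 < r)%N by exact: gallai_size_gt0.
have [e [e0 e1 ed]] : exists e, [/\ 0 < e, e <= 1 & e <= delta].
  by exists (Num.min delta 1); rewrite lt_min delta0 ltr01 !ge_min !lexx orbT.
(* Of the surplus [2 * e * n^2] in ordered pairs, [e * n^2] pays for the linear error of
   [turan_lower], and [2 * eta * n^2] is left. *)
pose eta := e / 2.
have eta0 : 0 < eta by rewrite /eta; lra.
have eta1 : eta <= 1 by rewrite /eta; lra.
pose P : finType := {ffun 'I_r.+1 * 'I_r.+1 -> 'I_k.+1}.
pose gamma := (eta ^+ 2 / 2) ^+ r.+1.
have gamma0 : 0 < gamma by rewrite exprn_gt0 // divr_gt0 ?exprn_gt0.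
(* The successor gives [#|P| * eps < gamma], as the pigeonhole argument requires. *)
pose eps : R := gamma / #|P|.+1%:R.
have eps0 : 0 < eps by rewrite divr_gt0 // ltr0n.
have [n1 box] := box_exists r.+1 eps0.
exists (maxn n1 (maxn 1 (Num.bound (eta ^+ 2 / 2)^-1))) => n.
rewrite !geq_max => /and3P[n1n n_gt0 bn] c.
rewrite ltNge; apply/negP => dense.
have big_n : 2 <= eta ^+ 2 * n%:R.
  have : 1 <= eta ^+ 2 / 2 * n%:R by
    rewrite mulrC -ler_pdivrMr ?mul1r ?divr_gt0 ?exprn_gt0 //;
    apply: le_trans (ltW (archi_boundP _)) _;
      rewrite ?ler_nat // invr_ge0 ltW // divr_gt0 ?exprn_gt0.
  by lra.
have n0 : 0 < n%:R :> R by rewrite ltr0n.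
have cliques : gamma * n%:R ^+ r.+1 <= (cnt r.+1 (pairwise (nim_adj c)))%:R.
  have := @many_cliques _ _ (nim_adj_sym c) R r eta r_gt0 eta0 eta1.
  rewrite card_ord -exprMn; apply=> //.
  have h1 := turan_lower n r;
    rewrite -(ler_nat R) natrX natrD !natrM -natr1 in h1.
  have h2 := nim_pairs c; rewrite -(ler_nat R) natrM in h2.
  have h3 : (n %/ r)%:R <= n%:R * r%:R^-1 :> R.
    by rewrite ler_pdivlMr ?ltr0n // -natrM ler_nat leq_trunc_div.
  have h4 : n%:R * (n %/ r)%:R <=
    n%:R * (n%:R * r%:R^-1) :> R by rewrite ler_pM2l.
  have h5 : e * n%:R ^+ 2 <= delta * n%:R ^+ 2 by rewrite ler_wpM2r ?sqr_ge0.
  have h6 : 1 <= e * n%:R.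
    have : e * (e * n%:R) <= e * n%:R by rewrite ler_piMl // mulr_ge0 // ltW.
    by move: big_n; rewrite /eta; lra.
  have h7 : n%:R <= n%:R * (e * n%:R) by rewrite ler_peMr // ltW.
  rewrite /eta; lra.
case: n n_gt0 => // n _ in c dense n1n bn big_n n0 cliques *.
pose f (z : seq 'I_n.+1) : P :=
  [ffun ij : 'I_r.+1 * 'I_r.+1 =>
    pair_col c (nth ord0 z ij.1) (nth ord0 z ij.2)].
(* Pigeonhole over color patterns; fixing [p] makes the color between two pairs the same at all
   corners of the box. *)
have [p hp] : exists p, eps * n.+1%:R ^+ r.+1 <=
    (cnt r.+1 (fun z => pairwise (nim_adj c) z && (f z == p)))%:R.
  apply/existsP; apply: contraT => /existsPn no.
  have : gamma * n.+1%:R ^+ r.+1 <= \sum_(p : P) eps * n.+1%:R ^+ r.+1.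
    apply: le_trans cliques _; rewrite (cnt_partition f) natr_sum.
    by apply: ler_sum => p _; rewrite ltW // ltNge no.
  rewrite sumr_const -[(eps * _) *+ _]mulr_natl mulrA ler_pM2r ?exprn_gt0 //.
  rewrite /eps mulrCA ler_pMr // ler_pdivlMr ?ltr0n // mul1r ler_nat.
  by rewrite ltnn.
have [||x [sx dx Ex]] := box _ (fun z =>
  pairwise (nim_adj c) z && (f z == p)) _ _.
- by rewrite card_ord.
- by rewrite card_ord.
suff : (r.+1 <= r)%N by rewrite ltnn.
apply: (@nim_box _ _ c r.+1 p ord0 x sx dx).
move=> b sb; have /andP[pw /eqP fp] := Ex b sb.
by split=> // i j; rewrite -fp ffunE.
Qed.

Theorem theorem1p1 (R : realType) (k : nat) (hk : (2 <= k)%N)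
    (delta : R) (hdelta : 0 < delta) :
  exists n0 : nat, forall n : nat, (n0 <= n)%N ->
    (turan n (GR (k - 1) 'K_3 - 1) <= fNIM k n 'K_3)%N /\
    (fNIM k n 'K_3)%:R <
      (turan n (GR (k - 1) 'K_3 - 1))%:R + delta * n%:R ^+ 2.
Proof.
case: k hk => [|[|k]] // _; rewrite !subn1 /= GR_K3 /=.
have [n0 upper] := fNIM_upper k.+1 hdelta.
exists n0 => n n0n; split; first exact: turan_le_fNIM.
have inhabited : (0 < #|coloring k.+2 'K_n|)%N.
  by apply/card_gt0P; exists [ffun=> ord0].
(* The maximum is attained, so the strict bound for single colorings carries over. *)
have [c maxE] := bigop.eq_bigmax
  (fun c : coloring k.+2 'K_n => #|[set e | nim c e]|) inhabited.
by rewrite [fNIM _ _ _]maxE; exact: upper.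
Qed.
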